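(* The set $X_{15}$ is contained in $S^{14}$ (where $X_{15} \subset \mathbb{R}^{16}$ lies in the $15$-dimensional subspace $[0_{\mathbb{R}^7}, \mathbf{1}_8, 0]^\perp$, whose unit sphere is identified with $S^{14}$) and represents $456$ biangular lines, with $A(X_{15}) \subseteq \{\pm\frac{1}{5}, \pm\frac{3}{5}\}$.
   Context: $S^{n-1}$ is the unit sphere of $\mathbb{R}^n$ and $(\cdot,\cdot)$ the standard inner product; $\mathbf{1}_8$ is the all-one vector of $\mathbb{R}^8$; $[\cdot,\cdot,\cdot]$ denotes concatenation of coordinates. For $X \subseteq \mathbb{R}^n$, $A(X) := \{(x,x') \mid x,x' \in X,\ x \neq x'\}$. A set $X \subset S^{d-1}$ represents a biangular line system if $A(X) \subseteq \{\pm\alpha, \pm\beta\}$ for some $0 \le \alpha < \beta < 1$; each $x \in X$ represents the line through the origin spanned by $x$ (so $X$ represents $|X|$ lines). Let $e_1,\dots,e_7$ be the standard basis of $\mathbb{R}^7$ and define $$\mathscr{E}_7 := \Bigl\{ \tfrac{1}{\sqrt{24}}\, \sigma(-3,-3,1,1,1,1,1,1) \;\Big|\; \sigma \in \mathrm{Sym}(8) \Bigr\} \subset \mathbb{R}^8,$$ where $\sigma(x_1,\dots,x_8) := [x_{\sigma(1)},\dots,x_{\sigma(8)}]$, $$B_7 := \{\pm e_i \mid 1 \le i \le 7\}, \qquad C_7 := \{ [\pm1,\dots,\pm1] \in \mathbb{R}^7 \mid \text{even number of } + \},$$ and $$X_{15} := \Bigl\{ \bigl[\sqrt{\tfrac25}\,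 b,\ \sqrt{\tfrac35}\, v,\ 0\bigr] \;\Big|\; b \in B_7,\ v \in \mathscr{E}_7 \Bigr\} \cup \Bigl\{ \bigl[\sqrt{\tfrac1{10}}\, c,\ 0_{\mathbb{R}^8},\ \sqrt{\tfrac3{10}}\bigr] \;\Big|\; c \in C_7 \Bigr\} \subset \mathbb{R}^7 \times \mathbb{R}^8 \times \mathbb{R}.$$ *)

(* Defs.v *)
From HB Require Import structures.
From mathcomp Require Import all_boot all_order all_algebra all_fingroup.
From mathcomp Require Import all_classical all_reals.

Set Implicit Arguments.
Unset Strict Implicit.
Unset Printing Implicit Defensive.

Import Order.TTheory GRing.Theory Num.Theory.
Local Open Scope classical_set_scope.
Local Open Scope ring_scope.

Section BiangularLines.
Variables (R : realType) (n : nat).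
Implicit Types (x y : 'rV[R]_n) (X : set 'rV[R]_n).

Definition dotp x y : R := \sum_i x 0 i * y 0 i.

Definition sphere : set 'rV[R]_n := [set x | dotp x x = 1].

(* A(X), where (x, x') denotes the inner product. *)
Definition inner_products X : set R :=
  [set a | exists x y, [/\ X x, X y, x <> y & a = dotp x y]].

Definition line x : set 'rV[R]_n := [set k *: x | k in [set: R]].

Definition biangular_line_system X : Prop :=
  X `<=` sphere /\
  exists alpha beta : R, [/\ 0 <= alpha, alpha < beta, beta < 1 &
    inner_products X `<=` [set alpha; - alpha; beta; - beta]].

Definition represents_biangular_lines X (k : nat) : Prop :=
  [/\ biangular_line_system X, (X #= `I_k)%card &
      ([set line x | x in X] #= `I_k)%card].

End BiangularLines.

Definition isometric_identification (R : realType) (m n : nat)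
    (H : set 'rV[R]_n) (phi : {linear 'rV[R]_m -> 'rV[R]_n}) : Prop :=
  (forall x y, dotp (phi x) (phi y) = dotp x y) /\ phi @` [set: 'rV[R]_m] = H.

Section X15.
Variable R : realType.

Definition concat3 (u : 'rV[R]_7) (v : 'rV[R]_8) (t : R) :
    'rV[R]_(7 + (8 + 1)) :=
  row_mx u (row_mx v (const_mx t)).

(* col_perm s x has coordinates x_(s 1), ..., x_(s 8). *)
Definition E7 : set 'rV[R]_8 :=
  [set (Num.sqrt 24)^-1 *: col_perm s (\row_(i < 8) (if (i < 2)%N then -3 else 1))
  | s in [set: 'S_8]].

Definition B7 : set 'rV[R]_7 :=
  [set b | exists i : 'I_7, b = delta_mx 0 i \/ b = - delta_mx 0 i].

Definition C7 : set 'rV[R]_7 :=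
  [set c | (forall i, c 0 i = 1 \/ c 0 i = -1) /\
           ~~ odd #|[pred i | c 0 i == 1]|].

Definition X15 : set 'rV[R]_(7 + (8 + 1)) :=
  [set x | exists b v, [/\ B7 b, E7 v &
     x = concat3 (Num.sqrt (2 / 5) *: b) (Num.sqrt (3 / 5) *: v) 0]] `|`
  [set x | exists2 c, C7 c &
     x = concat3 (Num.sqrt (1 / 10) *: c) 0 (Num.sqrt (3 / 10))].

Definition H15 : set 'rV[R]_(7 + (8 + 1)) :=
  [set x | dotp x (concat3 0 (const_mx 1) 0) = 0].

End X15.

Arguments sphere : clear implicits.
Arguments E7 : clear implicits.
Arguments B7 : clear implicits.
Arguments C7 : clear implicits.
Arguments X15 : clear implicits.
Arguments H15 : clear implicits.

(* Main.v *)
(* Up to scale, the vectors of E7 and C7 take two values, the first one on a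
   2-subset A of an 8-set and the second one on an even subset A of a 7-set, so
   all inner products reduce to |A|, |B| and |A :&: B|. None of them is 1 or
   -1 for distinct indices, so distinct indices give distinct lines, and there
   are 14 * 28 + 2^6 = 456 of them. Any isometric identification of the
   hyperplane with the 15-dimensional space transports this; a Householder
   reflection provides one. *)

Require Import Defs.
From HB Require Import structures.
From mathcomp Require Import all_boot all_order all_algebra all_fingroup.
From mathcomp Require Import all_classical all_reals.
From mathcomp Require Import ring lra zify.

Set Implicit Arguments.
Unset Strict Implicit.
Unset Printing Implicit Defensive.

Import Order.TTheory GRing.Theory Num.Theory.
Local Open Scope classical_set_scope.
Local Open Scope ring_scope.

(** * Bilinearity and definiteness of the inner product *)

Section InnerProduct.
Variables (R : realType) (n : nat).
Implicit Types (x y z a : 'rV[R]_n) (k : R).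

Lemma dotpE x y : dotp x y = (x *m y^T) 0 0.
Proof. by rewrite mxE; apply: eq_bigr => i _; rewrite mxE. Qed.

Lemma mulmx_trE x y : x *m y^T = (dotp x y)%:M.
Proof. by rewrite dotpE -mx11_scalar. Qed.

Lemma dotpC x y : dotp x y = dotp y x.
Proof. by apply: eq_bigr => i _; rewrite mulrC. Qed.

Lemma dotpDl x y z : dotp (x + y) z = dotp x z + dotp y z.
Proof. by rewrite !dotpE mulmxDl mxE. Qed.

Lemma dotpZl k x y : dotp (k *: x) y = k * dotp x y.
Proof. by rewrite !dotpE -scalemxAl mxE. Qed.

Lemma dotpDr x y z : dotp x (y + z) = dotp x y + dotp x z.
Proof. by rewrite dotpC dotpDl !(dotpC x). Qed.

Lemma dotpZr k x y : dotp x (k *: y) = k * dotp x y.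
Proof. by rewrite dotpC dotpZl dotpC. Qed.

Lemma dotpNl x y : dotp (- x) y = - dotp x y.
Proof. by rewrite -scaleN1r dotpZl mulN1r. Qed.

Lemma dotpNr x y : dotp x (- y) = - dotp x y.
Proof. by rewrite dotpC dotpNl dotpC. Qed.

Lemma dotp0l x : dotp 0 x = 0.
Proof. by rewrite -(scale0r 0) dotpZl mul0r. Qed.

Lemma dotp0r x : dotp x 0 = 0.
Proof. by rewrite dotpC dotp0l. Qed.

Lemma dotp_ge0 x : 0 <= dotp x x.
Proof. by apply: sumr_ge0 => i _; rewrite -expr2 sqr_ge0. Qed.

Lemma dotp_eq0 x : (dotp x x == 0) = (x == 0).
Proof.
apply/eqP/eqP => [|->]; last by rewrite dotp0l.
move=> /psumr_eq0P x0; apply/rowP => i; rewrite mxE; apply/eqP.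
by rewrite -sqrf_eq0 expr2 x0 // => j _; rewrite -expr2 sqr_ge0.
Qed.

Lemma dotp_deltar x j : dotp x (delta_mx 0 j) = x 0 j.
Proof.
rewrite /dotp (bigD1 j) //= mxE !eqxx mulr1 big1 ?addr0 // => i /negPf ij.
by rewrite mxE ij andbF mulr0.
Qed.

End InnerProduct.

Lemma dotp_row_mx (R : realType) m n (x1 y1 : 'rV[R]_m) (x2 y2 : 'rV[R]_n) :
  dotp (row_mx x1 x2) (row_mx y1 y2) = dotp x1 y1 + dotp x2 y2.
Proof. by rewrite !dotpE tr_row_mx mul_row_col mxE. Qed.

Lemma dotp_const_mx (R : realType) n (s t : R) :
  dotp (const_mx s : 'rV_n) (const_mx t) = s * t *+ n.
Proof.
rewrite -[in RHS](card_ord n) -sumr_const.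
by apply: eq_bigr => i _; rewrite !mxE.
Qed.

Lemma dotp_concat3 (R : realType) (u u' : 'rV[R]_7) v v' t t' :
  dotp (concat3 u v t) (concat3 u' v' t') = dotp u u' + dotp v v' + t * t'.
Proof. by rewrite !dotp_row_mx dotp_const_mx addrA. Qed.

(** * Isometric identification of a hyperplane *)

(* The Householder reflection along [w - |w| e_0] exchanges [w] and [|w| e_0],
   hence their orthogonal hyperplanes. If [w = |w| e_0], division by zero
   makes it the identity, as it should be. *)
Lemma hyperplane_identification (R : realType) m (w : 'rV[R]_(1 + m)) :
  w != 0 -> exists phi : {linear 'rV[R]_m -> 'rV[R]_(1 + m)},
    isometric_identification [set x | dotp x w = 0] phi.
Proof.
move=> w0; pose r := Num.sqrt (dotp w w).
pose e : 'rV[R]_(1 + m) := delta_mx 0 (lshift m 0).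
have rr : r * r = dotp w w by rewrite -expr2 sqr_sqrtr ?dotp_ge0.
have r0 : r != 0.
  by apply: contra_neq w0 => r0; apply/eqP; rewrite -dotp_eq0 -rr r0 mul0r.
have [a aE] : exists a, a = w - r *: e by exists (w - r *: e).
pose c := 2 / dotp a a.
have caa : a = 0 \/ c * dotp a a = 2.
  have [->|a0] := eqVneq a 0; [by left|right].
  by rewrite /c divfK // dotp_eq0.
pose S x := x - (c * dotp x a) *: a.
have dotpS x y : dotp (S x) (S y) = dotp x y.
  rewrite /S !(dotpDl, dotpDr, dotpNl, dotpNr, dotpZl, dotpZr) (dotpC a y).
  by case: caa => [->|caa]; [rewrite !dotp0r; ring|ring: caa].
have SK x : S (S x) = x.
  rewrite /S; apply/subr0_eq; rewrite dotpDl dotpNl dotpZl.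
  case: caa => [->|caa]; first by rewrite !scaler0 !subr0 subrr.
  rewrite addrAC [x - _]addrC addrK -opprD -scalerDl.
  apply/eqP; rewrite oppr_eq0 scaler_eq0; apply/orP; left; apply/eqP.
  by ring: caa.
have ee : dotp e e = 1 by rewrite dotp_deltar mxE !eqxx.
have Sw : S w = r *: e.
  have wE : w = a + r *: e by rewrite aE subrK.
  case: caa => [a0|caa]; first by rewrite /S a0 scaler0 subr0 wE a0 add0r.
  suff -> : S w = w - a by rewrite {1}wE addrC addKr.
  rewrite /S; congr (_ - _); rewrite -[RHS]scale1r; congr (_ *: _).
  (* Since [w] and [r *: e] have the same norm, both sides equal [2 * (r * r - r * dotp w e)]; hence
     [c * dotp w a = 1] and [S] subtracts exactly [a] from [w]. *)
  have : dotp a a = 2 * dotp w a.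
    rewrite aE !(dotpDl, dotpDr, dotpNl, dotpNr, dotpZl, dotpZr) ee -rr.
    by rewrite (dotpC e w); ring.
  by move=> aa; move: caa; rewrite aa; lra.
(* The embedding onto the hyperplane orthogonal to [e], followed by the matrix of the reflection
   [S]. *)
pose M : 'M[R]_(m, 1 + m) := row_mx 0 1%:M *m (1%:M - c *: (a^T *m a)).
have [phi phiE] : exists phi : {linear 'rV[R]_m -> 'rV[R]_(1 + m)},
    forall y, phi y = S (row_mx 0 y).
  exists (mulmxr M) => y; rewrite /= /M mulmxA mul_mx_row mulmx0 mulmx1.
  rewrite mulmxBr mulmx1 -scalemxAr mulmxA mulmx_trE mul_scalar_mx.
  by rewrite scalerA.
exists phi; split=> [x y|].
  by rewrite !phiE dotpS dotp_row_mx dotp0l add0r.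
apply/seteqP; split=> [_ [y _ <-]|x /= xw].
  rewrite phiE /mkset -[w]SK dotpS Sw dotpZr dotp_deltar row_mxEl mxE.
  by rewrite mulr0.
(* If [x] is orthogonal to [w], then [S x] is orthogonal to [S w = r *: e], so its first coordinate
   vanishes and its last [m] coordinates give the preimage. *)
exists (rsubmx (S x)) => //; rewrite phiE -[RHS]SK; congr (S _).
rewrite -[RHS]hsubmxK; congr row_mx; apply/rowP => i.
rewrite [LHS]mxE [RHS]mxE ord1.
have : dotp (S x) (S w) = 0 by rewrite dotpS.
by rewrite Sw dotpZr dotp_deltar => /eqP; rewrite mulf_eq0 (negPf r0) /= => /eqP ->.
Qed.

(** * Lines spanned by unit vectors, and transport along isometries *)

Section UnitVectors.
Variables (R : realType) (n : nat).
Implicit Types (x y : 'rV[R]_n) (X : set 'rV[R]_n).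

(** Writing [x = k *: y], the norms give [k ^+ 2 = 1], and [k] is the inner product. *)
Lemma line_eq_unit x y : dotp x x = 1 -> dotp y y = 1 -> line x = line y ->
  dotp x y = 1 \/ dotp x y = -1.
Proof.
move=> x1 y1 xy; have : line x x by exists 1; rewrite ?scale1r.
rewrite xy => -[k _ kyx]; move: x1; rewrite -kyx !dotpZl dotpZr y1 !mulr1.
by rewrite -expr2 => /eqP; rewrite sqrf_eq1 => /orP[] /eqP; [left|right].
Qed.

(** As 0 <= alpha < beta < 1, distinct vectors of [X] never have inner product 1 or -1, so [line] is
    injective on [X] and there are as many lines as vectors. *)
Lemma biangular_represents X k :
  biangular_line_system X -> (X #= `I_k)%card ->
  represents_biangular_lines X k.
Proof.
move=> bX Xk; split=> //; apply: card_eq_trans Xk; apply: inj_card_eq.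
move=> x y; rewrite !inE => Xx Xy xy; apply: contrapT => xNy.
have [Xs [al [be [al0 ab be1 XA]]]] := bX.
have : inner_products X (dotp x y) by exists x, y.
move=> /XA /=.
have := line_eq_unit (Xs _ Xx) (Xs _ Xy) xy.
by move=> [|] -> [[[|]|]|]; lra.
Qed.

End UnitVectors.

Lemma isometry_inj (R : realType) m n (phi : {linear 'rV[R]_m -> 'rV[R]_n}) :
  (forall x y, dotp (phi x) (phi y) = dotp x y) -> injective phi.
Proof.
move=> phiD x y xy; apply/eqP; rewrite -subr_eq0 -dotp_eq0 -phiD.
by rewrite linearB xy subrr dotp0l.
Qed.

(** Because [X] lies in the range, [phi] restricts to an inner-product preserving bijection from the
    preimage onto [X]. *)
Lemma represents_biangular_preimage (R : realType) m n
    (phi : {linear 'rV[R]_m -> 'rV[R]_n}) (X : set 'rV[R]_n) k :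
  (forall x y, dotp (phi x) (phi y) = dotp x y) -> X `<=` range phi ->
  represents_biangular_lines X k ->
  represents_biangular_lines (phi @^-1` X) k.
Proof.
move=> phiD Xphi [[Xs [al [be [al0 ab be1 XA]]]] Xk _].
have phi_inj := isometry_inj phiD.
apply: biangular_represents; first split.
- by move=> x /Xs /=; rewrite /sphere /= phiD.
- exists al, be; split=> // _ [x [y [Xx Xy xy ->]]]; apply: XA.
  by exists (phi x), (phi y); split=> // /phi_inj.
- suff phiX : phi @` (phi @^-1` X) = X.
    apply: card_eq_trans Xk; rewrite -[X in (_ #= X)%card]phiX card_eq_sym.
    by apply: inj_card_eq => x y _ _ /phi_inj.
  apply/seteqP; split=> [_ [x Xx <-]//|x Xx].
  by have [y _ yx] := Xphi _ Xx; exists y => //=; rewrite yx.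
Qed.

(** * Vectors taking two values *)

(** Encoded by a base value and a jump on [A], so that it is affine in the indicator of [A]: (1, -4)
    gives the entries 1, -3 of [E7], and (-1, 2) the entries -1, 1 of [C7]. *)
Definition two_valued (R : realType) n (s t : R) (A : {set 'I_n}) : 'rV[R]_n :=
  \row_i (s + t *+ (i \in A)).

Lemma dotp_two_valued1 (R : realType) n (s t : R) (A : {set 'I_n}) :
  dotp (two_valued s t A) (const_mx 1) = s *+ n + t *+ #|A|.
Proof.
rewrite -[X in _ *+ X](card_ord n) -!sumr_const [X in _ + X]big_mkcond -big_split /=.
apply: eq_bigr => i _; rewrite !mxE mulr1.
by case: (i \in A); rewrite ?mulr1n ?mulr0n.
Qed.

Lemma dotp_two_valued (R : realType) n (s t : R) (A B : {set 'I_n}) :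
  dotp (two_valued s t A) (two_valued s t B) =
  s ^+ 2 *+ n + s * t *+ (#|A| + #|B|) + t ^+ 2 *+ #|A :&: B|.
Proof.
have sumA (C : {set 'I_n}) (k : R) : k *+ #|C| = \sum_i k *+ (i \in C).
  by rewrite -sumr_const big_mkcond; apply: eq_bigr => i _; case: (i \in C).
rewrite mulrnDr !sumA -[X in _ *+ X](card_ord n) -sumr_const -!big_split /=.
apply: eq_bigr => i _; rewrite !mxE inE.
by case: (i \in A); case: (i \in B); rewrite /= ?mulr1n ?mulr0n; ring.
Qed.


(** * Counting the indices *)

Lemma card_eq_seq (T : choiceType) (s : seq T) :
  uniq s -> ([set x | x \in s] #= `I_(size s))%card.
Proof.
case: s => [|x0 s'] us.
  by rewrite (_ : [set x | _] = set0) ?II0 ?card_eq00 // -subset0 => x.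
set s := x0 :: s'; rewrite card_eq_sym.
have -> : [set x | x \in s] = nth x0 s @` `I_(size s).
  apply/seteqP; split=> [x /= /(nthP x0)[i si <-]|_ [i /= si <-]].
    by exists i.
  exact: mem_nth.
rewrite card_eq_sym; apply: inj_card_eq => i j; rewrite !inE => si sj /eqP.
by rewrite (nth_uniq x0 si sj us) => /eqP.
Qed.

(** Toggling the membership of a fixed [t] is an involution exchanging even and odd subsets, so each
    kind makes up half of the power set. *)
Lemma card_even_sets (T : finType) :
  (0 < #|T|)%N -> #|[set A : {set T} | ~~ odd #|A|]%SET| = (2 ^ #|T|.-1)%N.
Proof.
move=> /card_gt0P[t _].
pose toggle (A : {set T}) := if t \in A then A :\ t else t |: A.
have toggleK : involutive toggle.
  move=> A; rewrite /toggle; case: (boolP (t \in A)) => tA; last first.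
    by rewrite setU11 setU1K.
  by rewrite setD11 finset.setD1K.
have odd_toggle A : odd #|toggle A| = ~~ odd #|A|.
  rewrite /toggle; case: ifPn => tA; last by rewrite cardsU1 tA.
  by rewrite [in RHS](cardsD1 t) tA /= negbK.
set E := [set A | _]%SET; have : #|~: E| = #|E|.
  rewrite -(card_imset _ (inv_inj toggleK)); congr #|pred_of_set _|.
  apply/setP => A; rewrite -[A in LHS]toggleK mem_imset; last exact: inv_inj.
  by rewrite !inE odd_toggle negbK.
have := cardsC E; rewrite -cardsT -powersetT card_powerset cardsT => + EE; rewrite EE.
have T0 : (0 < #|T|)%N by apply/card_gt0P; exists t.
rewrite -{1}(prednK T0) expnS; lia.
Qed.

(** The intersection is no larger than either set, so equality forces it to fill both. This decides
    equality of indices by the same cardinals that determine inner products. *)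
Lemma eq_card_setI (T : finType) (A B : {set T}) :
  (A == B) = (#|A| + #|B| == 2 * #|A :&: B|%SET)%N.
Proof.
apply/eqP/eqP => [->|AB]; first by rewrite finset.setIid addnn mul2n.
have IA := subset_leq_card (subsetIl A B).
have IB := subset_leq_card (subsetIr A B).
have -> : A = (A :&: B)%SET by apply/esym/eqP; rewrite eqEcard subsetIl; lia.
by apply/eqP; rewrite eqEcard subsetIr; lia.
Qed.

(** Left: sign of the basis vector ([true] for minus), its position, and the positions of the
    entries -3. Right: the positions of the entries + of a vector of [C7]. *)
Definition index15 := (bool * 'I_7 * {set 'I_8} + {set 'I_7})%type.

Definition valid15 (k : index15) :=
  match k with inl (_, _, A) => #|A| == 2%N | inr A => ~~ odd #|A| end.

Lemma card_valid15 : #|[pred k | valid15 k]| = 456%N.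
Proof.
rewrite -sum1_card big_sumType /= !sum1dep_card.
have -> : [set A : {set 'I_7} | inr A \in [pred k | valid15 k]]%SET =
    [set A : {set 'I_7} | ~~ odd #|A|]%SET by apply/setP => A; rewrite !inE.
have -> : [set x | inl x \in [pred k | valid15 k]]%SET =
    finset.setX [set: bool * 'I_7] [set A : {set 'I_8} | #|A| == 2%N]%SET.
  by apply/setP => -[[s i] A]; rewrite !inE.
by rewrite cardsX cardsT card_prod card_bool card_draws card_even_sets !card_ord.
Qed.

(** * Parametrization of [X15] and its inner products *)

Section System15.
Variable R : realType.

Definition vec15 (k : index15) : 'rV[R]_(7 + (8 + 1)) :=
  match k with
  | inl (s, i, A) =>
    concat3 (Num.sqrt (2 / 5) *: ((-1) ^+ s *: delta_mx 0 i))
            (Num.sqrt (3 / 5) *: ((Num.sqrt 24)^-1 *: two_valued 1 (-4) A)) 0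
  | inr A =>
    concat3 (Num.sqrt (1 / 10) *: two_valued (-1) 2 A) 0 (Num.sqrt (3 / 10))
  end.

Lemma E7E :
  E7 R = [set (Num.sqrt 24)^-1 *: two_valued 1 (-4) A
         | A in [set A : {set 'I_8} | #|A| = 2%N]].
Proof.
have permE (s : 'S_8) :
    col_perm s (\row_(i < 8) (if (i < 2)%N then -3 else 1)) =
    two_valued 1 (-4 : R) (s @^-1: [set i : 'I_8 | (i < 2)%N])%SET.
  by apply/rowP => i; rewrite !mxE !inE; case: ifP => _ /=; ring.
have two : [set i : 'I_8 | (i < 2)%N]%SET = [set 0; 1]%SET.
  by apply/setP => -[[|[|i]] i8]; rewrite !inE.
apply/seteqP; split=> [_ [s _ <-]|_ [A /= /eqP/cards2P[a [b [ab ->]]] <-]].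
  rewrite permE; eexists; last reflexivity.
  rewrite /= two on_card_preimset ?cards2 //.
  by exists (s^-1)%g => i _; rewrite ?permK ?permKV.
(* A permutation taking {a, b} to {0, 1}: the first transposition sends [a] to 0 and [b] to [b']; as
   [b'] is not 0, the second one fixes 0 and sends [b'] to 1. *)
pose b' := tperm a 0 b.
have b'0 : b' != 0.
  by rewrite -(inj_eq (@perm_inj _ (tperm a 0))) tpermK tpermR eq_sym.
exists (tperm a 0 * tperm b' 1%R)%g => //; rewrite permE two.
congr (_ *: two_valued _ _ _).
apply/setP => i; rewrite -[i in RHS](tpermK a 0).
rewrite !inE permM; move: (tperm a 0 i) => j.
rewrite (canF_eq (tpermK b' 1)) (canF_eq (tpermK b' 1)) tpermR tpermD //.
by rewrite !(canF_eq (tpermK a 0)) tpermL -/b'.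
Qed.

Lemma X15E : X15 R = [set vec15 k | k in [set k | valid15 k]].
Proof.
rewrite /X15 E7E; apply/seteqP; split.
- move=> _ [[b [v [[i bi] [A /= A2 <-] ->]]]|[c [cpm cev] ->]].
  + case: bi => ->; [exists (inl (false, i, A))|exists (inl (true, i, A))] => /=;
      rewrite ?A2 //.
    * by rewrite expr0 scale1r.
    * by rewrite expr1 scaleN1r.
  + pose A := [set i | c 0 i == 1]%SET.
    exists (inr A) => /=; first by rewrite cardsE.
    congr (concat3 (_ *: _) _ _); apply/rowP => i; rewrite !mxE inE.
    have [->|->] := cpm i; first by rewrite eqxx mulr1n; ring.
    by rewrite eqNr oner_eq0 mulr0n addr0.
- move=> _ [[[[s i] A]|A] /= vA <-]; [left|right].
  + do 2!eexists; split; last reflexivity.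
    * exists i; case: s => /=; [right|left]; rewrite ?expr1 ?scaleN1r //.
      by rewrite expr0 scale1r.
    * by exists A => //; apply/eqP.
  + exists (two_valued (-1) 2 A) => //; split=> [i|].
      rewrite mxE; case: (i \in A); [left|right]; rewrite ?mulr1n ?addr0 //.
      by ring.
    suff -> : #|[pred i | two_valued (-1) (2 : R) A 0 i == 1]| = #|A| by [].
    apply: eq_card => i; rewrite !inE mxE; case: (i \in A).
      by apply/eqP; rewrite mulr1n; ring.
    by rewrite mulr0n addr0 eqNr oner_eq0.
Qed.

Lemma dotp_sqrtZ n (k : R) (x y : 'rV[R]_n) : 0 <= k ->
  dotp (Num.sqrt k *: x) (Num.sqrt k *: y) = k * dotp x y.
Proof. by move=> k0; rewrite dotpZl dotpZr mulrA -expr2 sqr_sqrtr. Qed.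

Lemma dotp_B7 (s t : bool) (i j : 'I_7) :
  dotp ((-1) ^+ s *: delta_mx 0 i) ((-1) ^+ t *: delta_mx 0 j) =
  (-1) ^+ (s (+) t) *+ (i == j) :> R.
Proof.
rewrite dotpZl dotpZr dotp_deltar mxE eqxx eq_sym mulrA -signr_addb.
by case: (i == j); rewrite ?mulr1 ?mulr0.
Qed.

(** With m the size of the intersection, the sum is (8 - 16 + 16 m) / 24, that is -1/3, 1/3 or 1. *)
Lemma dotp_E7 (A B : {set 'I_8}) : #|A| = 2%N -> #|B| = 2%N ->
  dotp ((Num.sqrt 24)^-1 *: two_valued 1 (-4 : R) A)
       ((Num.sqrt 24)^-1 *: two_valued 1 (-4) B) =
  (2 * #|A :&: B|%SET%:R - 1) / 3.
Proof.
move=> A2 B2; rewrite dotpZl dotpZr dotp_two_valued A2 B2 mulrA -invfM.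
by rewrite -expr2 sqr_sqrtr // -[_ *+ #|_|]mulr_natr; field.
Qed.

(** The scalings multiply to sqrt(1/25) and the selected entry is 1 or -1, so the value is 1/5 or
    -1/5. *)
Lemma dotp_B7_C7 (s : bool) (i : 'I_7) (B : {set 'I_7}) :
  [set 1 / 5; - (1 / 5); 3 / 5; - (3 / 5)]
    (dotp (Num.sqrt (2 / 5) *: ((-1) ^+ s *: delta_mx 0 i))
          (Num.sqrt (1 / 10) *: two_valued (-1) (2 : R) B)).
Proof.
rewrite dotpC !dotpZl !dotpZr dotp_deltar mxE mulrA -sqrtrM; last by lra.
have -> : 1 / 10 * (2 / 5) = (1 / 5) ^+ 2 :> R by field.
rewrite sqrtr_sqr ger0_norm; last by lra.
by case: s; case: (i \in B) => /=;
  first [left; left; left; lra | left; left; right; lra].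
Qed.

Lemma dotp_vec15 k l : valid15 k -> valid15 l ->
  if k == l then dotp (vec15 k) (vec15 l) = 1
  else [set 1 / 5; - (1 / 5); 3 / 5; - (3 / 5)] (dotp (vec15 k) (vec15 l)).
Proof.
move: k l => [[[s i] A]|A] [[[t j] B]|B] /=.
(* The [E7] parts contribute -1/5, 1/5 or 3/5, and the [B7] parts 0, 2/5 or -2/5. The sum is 1 only
   for 2/5 + 3/5, that is for equal indices. *)
- move=> /eqP A2 /eqP B2.
  rewrite dotp_concat3 mulr0 addr0 !dotp_sqrtZ; [|lra..].
  rewrite dotp_B7 dotp_E7 //.
  have -> : (inl (s, i, A) == inl (t, j, B) :> index15) =
    [&& s == t, i == j & A == B] by rewrite andbA.
  rewrite eq_card_setI A2 B2.
  have := subset_leq_card (subsetIl A B); rewrite A2.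
  case: #|_| => [|[|[|//]]] _; case: s; case: t; case: (i == j) => /=;
    first [lra | left; left; left; lra | left; left; right; lra
               | left; right; lra | right; lra].
- by move=> _ _; rewrite dotp_concat3 dotp0r addr0 mul0r addr0; apply: dotp_B7_C7.
- move=> _ _; rewrite dotp_concat3 dotp0l addr0 mulr0 addr0 dotpC.
  exact: dotp_B7_C7.
- move=> evA evB.
  rewrite dotp_concat3 dotp0l addr0 dotp_sqrtZ; last by lra.
  rewrite -expr2 sqr_sqrtr; last by lra.
  rewrite dotp_two_valued.
  have -> : (inr A == inr B :> index15) = (A == B) by [].
  rewrite eq_card_setI.
  have UI := cardsUI A B.
  have U7 : (#|A :|: B|%SET <= 7)%N.
    by have := max_card (mem (A :|: B)%SET); rewrite card_ord.
  (* The symmetric difference of two even sets has even size 2d. The inner product becomes (7 -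
     4d)/10 + 3/10 = 1 - 2d/5. *)
  have [d dE] : exists d, (#|A| + #|B| = 2 * #|A :&: B|%SET + 2 * d)%N.
    have := subset_leq_card (subsetIl A B).
    have := subset_leq_card (subsetIr A B).
    move: evA evB {UI}; move: #|A| #|B| #|_| => a b m evA evB mB mA.
    by exists ((a + b)./2 - m)%N; lia.
  (* The union contains the symmetric difference, so 2d <= 7, which leaves the values 1, 3/5, 1/5
     and -1/5. *)
  have : (d < 4)%N by lia.
  rewrite dE.
  rewrite -[_ *+ #|_|]mulr_natr -[_ *+ (_ + _)]mulr_natr natrD !natrM.
  rewrite -[X in _ == X]addn0 eqn_add2l.
  case: d {dE} => [|[|[|[|//]]]] _ /=;
    first [lra | left; left; left; lra | left; left; right; lra
               | left; right; lra | right; lra].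
Qed.

Lemma dotp_X15 x y : X15 R x -> X15 R y -> x = y /\ dotp x y = 1 \/
  [set 1 / 5; - (1 / 5); 3 / 5; - (3 / 5)] (dotp x y).
Proof.
rewrite X15E => -[k vk <-] [l vl <-]; have := dotp_vec15 vk vl.
by case: eqVneq => [->|]; [left|right].
Qed.

Lemma X15_sphere : X15 R `<=` sphere R (7 + (8 + 1)).
Proof.
move=> x; rewrite X15E => -[k vk <-].
by have := dotp_vec15 vk vk; rewrite eqxx.
Qed.

Lemma inner_products_X15 :
  inner_products (X15 R) `<=` [set 1 / 5; - (1 / 5); 3 / 5; - (3 / 5)].
Proof. by move=> _ [x [y [Xx Xy xy ->]]]; case: (dotp_X15 Xx Xy) => [[]|]. Qed.

Lemma X15_biangular : biangular_line_system (X15 R).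
Proof.
split; first exact: X15_sphere.
exists (1 / 5), (3 / 5); split; [lra..|exact: inner_products_X15].
Qed.

Lemma card_X15 : (X15 R #= `I_456)%card.
Proof.
(* If distinct indices gave the same vector, its squared norm 1 would be one of the four admissible
   values. *)
have vec15_inj : {in [set k | valid15 k] &, injective vec15}.
  move=> k l; rewrite !inE => vk vl kl; have := dotp_vec15 vk vl.
  case: eqVneq => // _; have := dotp_vec15 vl vl; rewrite eqxx kl => -> /=.
  by move=> one; exfalso; case: one => [[[|]|]|]; lra.
rewrite X15E; apply: card_eq_trans (inj_card_eq vec15_inj) _.
rewrite -card_valid15 cardE.
have -> : [set k | valid15 k] = [set k | k \in enum [pred k | valid15 k]].
  by apply/seteqP; split=> k; rewrite /= mem_enum.
exact/card_eq_seq/enum_uniq.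
Qed.

Lemma X15_hyperplane : X15 R `<=` H15 R.
Proof.
rewrite X15E => _ [[[[s i] A]|A] vA <-]; rewrite /H15 /= dotp_concat3 dotp0r.
  move: vA => /= /eqP A2; rewrite !dotpZl dotp_two_valued1 A2.
  (* The entries of a vector of [E7] sum, up to scale, to 8 - 4 * 2. *)
  by rewrite (_ : 1 *+ 8 + _ = 0) ?mulr0 ?addr0 //; ring.
by rewrite dotp0l mulr0 !addr0.
Qed.
End System15.

(** * Assembly, and transport to the 15-dimensional space *)

Theorem proposition8p2 (R : realType) :
  [/\ X15 R `<=` H15 R `&` sphere R (7 + (8 + 1)),
      inner_products (X15 R) `<=` [set 1 / 5; - (1 / 5); 3 / 5; - (3 / 5)],
      represents_biangular_lines (X15 R) 456,
      exists phi : {linear 'rV[R]_15 -> 'rV[R]_(7 + (8 + 1))},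
        isometric_identification (H15 R) phi &
      forall phi : {linear 'rV[R]_15 -> 'rV[R]_(7 + (8 + 1))},
        isometric_identification (H15 R) phi ->
        X15 R `<=` phi @` sphere R 15 /\
        represents_biangular_lines (phi @^-1` X15 R) 456].
Proof.
have X15_lines := biangular_represents (X15_biangular R) (card_X15 R).
split=> //.
- by move=> x Xx; split; [exact: X15_hyperplane|exact: X15_sphere].
- exact: inner_products_X15.
(* The normal vector is nonzero, its squared norm being 8; the dimension 7 + (8 + 1) is read as 1 +
   15. *)
- apply: (@hyperplane_identification R 15); rewrite -dotp_eq0 dotp_concat3.
  by rewrite dotp0l dotp_const_mx mulr0 add0r addr0 mulr1 pnatr_eq0.
- move=> phi [phiD phiH].
  have Xphi : X15 R `<=` range phi by rewrite phiH; exact: X15_hyperplane.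
  split; last exact: represents_biangular_preimage.
  move=> x Xx; have [y _ yx] := Xphi _ Xx; exists y => //.
  by rewrite /sphere /= -phiD yx; exact: X15_sphere.
Qed.
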